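(* Consider $n$ bidders in a repeated multi-position VCG auction with $k<n$ positions, position multipliers $p_1\ge\dots\ge p_k\ge 0=p_{k+1}=\dots=p_n$ satisfying $p_i-p_{i+1}\ge\rho$ for all $i\le k$ (with $\rho>0$), and value/bid grid $V=\{\frac1H,\frac2H,\dots,1\}$, where every bidder runs the learning algorithm consisting of $T_0$ rounds of pure uniform exploration followed by a $\gamma_t$-mean-based contextual learning algorithm. Suppose there is a constant $\tau>0$ with $\tau\le\frac{1}{H^{n-1}}$ and $g_i^{(k)}(v)\ge\tau$ for all $i\in[n]$ and $v\in V$ (thickness assumption). Suppose $T_0$ is large enough that $$\exp\left(-\frac{\tau^2\rho^2T_0}{32n^2H^2}\right)\le\frac12\qquad\text{and}\qquad\gamma_t\le\frac{\tau\rho}{8nH}\quad\text{for all }t\ge T_0 .$$ Then for every time $t>T_0$, every bidder $i$, and every fixed value $v\in V$, given $v_{i,t}=v$, bidder $i$ submits the truthful bid $b_{i,t}=v_{i,t}$ with probability at least $$1-H\gamma_t-4\exp\left(-\frac{\tau^2\rho^2T_0}{32n^2H^2}\right).$$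
   Context: Setting. $H$ is a positive integer and $V=\{\frac1H,\frac2H,\dots,1\}$. There are $n$ bidders and rounds $t=1,2,\dots$. Bidder $i$'s value $v_{i,t}\in V$ in round $t$ is drawn from a distribution $F_i$ on $V$, independently over rounds and across bidders, and bidder $i$ submits a bid $b_{i,t}\in V$ depending on $v_{i,t}$, past information and private randomness (independent across bidders). Write $b_{-i,t}$ for the bids of bidders other than $i$. Let $z_i^{(k)}$ be the $k$-th largest value among the bidders other than $i$, $G_i^{(k)}$ its distribution, and $g_i^{(k)}$ the probability mass function of $G_i^{(k)}$ on $V$. Multi-position VCG auction. In each round the bidders are sorted in descending order of bids, $b_{(1)}\ge b_{(2)}\ge\dots\ge b_{(n)}$, with ties broken uniformly at random; the bidder ranked $r$ gets position $r$ (positions $r>k$ have multiplier $0$, i.e. no slot). The bidder in position $r\le k$ pays $\sum_{j=r}^{k}(p_j-p_{j+1})b_{(j+1)}$, so if her value is $v$ her utility is $\sum_{j=r}^{k}(p_j-p_{j+1})(v-b_{(j+1)})$; bidders in positions $r>k$ have utility $0$. $u_{i,t}((b,b_{-i,t});v)$ denotes the utility of bidder $i$ in round $t$ when she has value $v$, bids $b$, and the others bid $b_{-i,t}$. Mean-based contextual learning algorithm. Let $r_{a,t}(c)$ be the reward of action $a$ at time $t$ when the context is $c$, and $\sigma_{a,t}(c)=\sum_{s=1}^t r_{a,s}(c)$. An algorithm is $\gamma_t$-mean-based if whenever $\sigma_{a,t}(c)<\sigma_{b,t}(c)-\gamma_t t$, the probability that the algorithm plays action $a$ on round $t+1$, given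 context $c$, is at most $\gamma_t$. Here $(\gamma_t)$ is a sequence such that $\gamma_t t$ is increasing in $t$ and $\gamma_t\to0$ as $t\to\infty$. For bidder $i$ the context in round $t$ is her value, the actions are the bids in $V$, and the reward of bid $b$ in context $v$ at time $t$ is $u_{i,t}((b,b_{-i,t});v)$ (defined for every $v\in V$ and every $b\in V$ in every round, including exploration rounds). Bidders' algorithm with parameters $(\gamma_t,T_0)$. For $t=1,\dots,T_0$ each bidder chooses $b_{i,t}$ uniformly at random from $V$ (regardless of her value, independently across bidders and rounds). For $t>T_0$ she observes $v_{i,t}$ and chooses $b_{i,t}$ by a $\gamma_t$-mean-based contextual learning algorithm. All bidders share the same $\gamma_t$ and $T_0$.
   Formalization: The formal theorem also assumes ρ ≤ 1 (the usual normalization of multipliers); without it the claim fails, e.g. n=2, k=1, H=2, uniform values, τ=1/2, T_0=1, p_1=ρ huge, γ_t tiny. *)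

(* Defs.v *)
From HB Require Import structures.
From mathcomp Require Import all_boot all_order all_algebra all_fingroup.
From mathcomp Require Import all_classical all_reals all_analysis.

Set Implicit Arguments.
Unset Strict Implicit.
Unset Printing Implicit Defensive.

Import Order.TTheory GRing.Theory Num.Theory numFieldNormedType.Exports.

Local Open Scope classical_set_scope.
Local Open Scope ring_scope.

(* The grid V = {1/H, ..., 1} is indexed by 'I_H, a standing for (a + 1) / H;
   comparing indices is comparing grid points. *)
Definition grid (R : realType) (H : nat) (a : 'I_H) : R := a.+1%:R / H%:R.

Definition profile (n H : nat) : finType := {ffun 'I_n -> 'I_H}.

Definition is_pmf (R : realType) (T : finType) (f : T -> R) : Prop :=
  (forall x, 0 <= f x) /\ \sum_x f x = 1.

(* k-th largest (k >= 1), counted with multiplicity, of the entries of x other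
   than the i-th, as a grid index. *)
Definition kth_other (n H k : nat) (i : 'I_n) (x : profile n H) : nat :=
  nth 0%N (sort geq [seq val (x j) | j <- enum 'I_n & j != i]) k.-1.

(* The probability mass function g_i^(k) when the values are independent with
   x j of law F j. *)
Definition kth_other_pmf (R : realType) (n H k : nat) (F : 'I_n -> 'I_H -> R)
    (i : 'I_n) (v : 'I_H) : R :=
  \sum_(x : profile n H | kth_other k i x == v) \prod_j F j (x j).

(* Ties are broken by a priority order s : 'S_n; breaking them uniformly at
   random means drawing s uniformly. *)
Definition ahead (n H : nat) (b : profile n H) (s : 'S_n) : rel 'I_n :=
  fun i j => (b j < b i)%N || ((b i == b j) && (s i <= s j)%N).

Definition standing (n H : nat) (b : profile n H) (s : 'S_n) : seq 'I_n :=
  sort (ahead b s) (enum 'I_n).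

(* Positions are numbered from 1. *)
Definition position (n H : nat) (b : profile n H) (s : 'S_n) (i : 'I_n) : nat :=
  (index i (standing b s)).+1.

(* b_(r), for 1 <= r <= n *)
Definition ranked_bid (R : realType) (n H : nat) (b : profile n H) (s : 'S_n)
    (r : nat) : R :=
  nth 0 [seq grid R (b j) | j <- standing b s] r.-1.

(* The sum is empty when i is in a position r > k. *)
Definition utility (R : realType) (n H k : nat) (p : nat -> R)
    (b : profile n H) (s : 'S_n) (i : 'I_n) (v : 'I_H) : R :=
  \sum_(position b s i <= j < k.+1)
    (p j - p j.+1) * (grid R v - ranked_bid R b s j.+1).

(* What happens in one round: the values, the bids and the priority order. *)
Definition round (n H : nat) : finType :=
  (profile n H * profile n H * 'S_n)%type.
Definition values (n H : nat) (o : round n H) : profile n H := o.1.1.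
Definition bids (n H : nat) (o : round n H) : profile n H := o.1.2.
Definition priority (n H : nat) (o : round n H) : 'S_n := o.2.

Definition set_bid (n H : nat) (b : profile n H) (i : 'I_n) (a : 'I_H) :
    profile n H :=
  [ffun j => if j == i then a else b j].

(* u_i((a, b_{-i}); c), under the realized tie-breaking order of the round *)
Definition reward (R : realType) (n H k : nat) (p : nat -> R) (i : 'I_n)
    (o : round n H) (a c : 'I_H) : R :=
  utility k p (set_bid (bids o) i a) (priority o) i c.

(* A contextual learning algorithm gives the law of the next action from the
   past observations, oldest first, and the context. *)
Definition learner (R : realType) (O C A : Type) := seq O -> C -> A -> R.

Definition cumulative (R : realType) (O C A : Type) (r : O -> A -> C -> R)
    (h : seq O) (a : A) (c : C) : R :=
  \sum_(o <- h) r o a c.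

(* T0 is the first t for which the condition is imposed, i.e. round T0 + 1 is
   the first one played by the algorithm. *)
Definition mean_based (R : realType) (O C A : Type) (gamma : nat -> R)
    (T0 : nat) (r : O -> A -> C -> R) (alg : learner R O C A) : Prop :=
  forall (h : seq O) (c : C) (a b : A), (T0 <= size h)%N ->
    cumulative r h a c < cumulative r h b c - gamma (size h) * (size h)%:R ->
    alg h c a <= gamma (size h).

Definition bidding_algorithm (R : realType) (n H k : nat) (p : nat -> R)
    (gamma : nat -> R) (T0 : nat) (i : 'I_n)
    (alg : learner R (round n H) 'I_H 'I_H) : Prop :=
  [/\ forall h c, is_pmf (alg h c),
      forall h c a, (size h < T0)%N -> alg h c a = H%:R^-1
    & mean_based gamma T0 (reward k p i) alg].

(* Conditional law of a round given the history h: independent values, then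
   independent bids, each depending on h and the bidder's own value only, and
   an independent uniform priority order. *)
Definition round_law (R : realType) (n H : nat) (F : 'I_n -> 'I_H -> R)
    (alg : 'I_n -> learner R (round n H) 'I_H 'I_H)
    (h : seq (round n H)) (o : round n H) : R :=
  (\prod_i (F i (values o i) * alg i h (values o i) (bids o i))) / n`!%:R.

(* Rounds 1, ..., t of the process X (X 0 is not used). *)
Definition history (Omega : Type) (n H : nat)
    (X : nat -> Omega -> round n H) (t : nat) (w : Omega) : seq (round n H) :=
  [seq X s w | s <- iota 1 t].

Definition auction_process (R : realType) (d : measure_display)
    (Omega : measurableType d) (P : probability Omega R) (n H : nat)
    (F : 'I_n -> 'I_H -> R) (alg : 'I_n -> learner R (round n H) 'I_H 'I_H)
    (X : nat -> Omega -> round n H) : Prop :=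
  (forall t o, measurable [set w | X t w = o]) /\
  (forall t h o, size h = t ->
    P [set w | history X t w = h /\ X t.+1 w = o] =
    (P [set w | history X t w = h] * (round_law F alg h o)%:E)%E).

Definition cond_prob (R : realType) (d : measure_display)
    (Omega : measurableType d) (P : probability Omega R)
    (A B : set Omega) : R :=
  fine (P (A `&` B)) / fine (P B).

(* Law of bidder i's bid in round t given v_{i,t} = v, as a kernel in v: the
   average over the past of the algorithm's answer to v.  It is a version of
   the conditional law that makes sense also for values of probability 0. *)
Definition bid_law_given (R : realType) (d : measure_display)
    (Omega : measurableType d) (P : probability Omega R) (n H : nat)
    (alg : 'I_n -> learner R (round n H) 'I_H 'I_H)
    (X : nat -> Omega -> round n H) (i : 'I_n) (t : nat) (v a : 'I_H) : R :=
  fine 'E_P[fun w => alg i (history X t.-1 w) v a].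

(* Main.v *)
(** With the others' bids and the priority order fixed, the utility of bidder
    [i] is a sum over [j <= k] of [(p_j - p_(j+1)) (v - c_j)] restricted to the
    [j] such that [i] beats the [j]-th best rival, whose bid is [c_j].  So a bid
    [a] never earns more than [v], and it loses at least [rho / H] in the rounds
    costly for [a], where [c_k = a] and the tie at [a] is broken the wrong way.
    Given the past, a round is costly with probability at least [7 tau / (8 n)],
    both during the exploration and as long as every algorithm is truthful up to
    [H gamma].  Mean-based algorithms are truthful in this sense unless the number
    of costly rounds has fallen below [tau t / (8 n)] for some bidder, value and
    bid.  The sum of the exponential supermartingales of these counts is at least
    [exp (tau T0 / (4 n))] at the first such time and starts at [n H^2], which
    bounds the probability of ever leaving the truthful regime. *)

Require Import Defs.
From mathcomp Require Import all_boot all_order all_algebra all_fingroup.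
From mathcomp Require Import all_classical all_reals all_analysis.
From mathcomp Require Import measurable_realfun.
From mathcomp Require Import ring lra zify.

Set Implicit Arguments.
Unset Strict Implicit.

Import Order.TTheory GRing.Theory Num.Theory numFieldNormedType.Exports.

Local Open Scope classical_set_scope.
Local Open Scope ring_scope.

(** * The ranking order, and the utility expressed through the rivals of one bidder *)

Lemma ahead_total n H (b : profile n H) s : total (ahead b s).
Proof.
move=> i j; rewrite /ahead; have [h|h|h] := ltngtP (b j) (b i); rewrite ?orbT //.
by rewrite (val_inj h) eqxx /= leq_total.
Qed.

Lemma ahead_trans n H (b : profile n H) s : transitive (ahead b s).
Proof.
move=> j i l; rewrite /ahead.
case/orP=> [h1|/andP[/eqP-> s1]]; case/orP=> [h2|/andP[/eqP e2 s2]].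
- by rewrite (ltn_trans h2 h1).
- by rewrite -e2 h1.
- by rewrite h2.
- by rewrite e2 eqxx (leq_trans s1 s2) orbT.
Qed.

(** Equal bids are separated by the priority [s], which is injective. Hence [ahead] is a linear
    order, and a sorted list is determined by its entries. *)
Lemma ahead_anti n H (b : profile n H) s : antisymmetric (ahead b s).
Proof.
move=> i j; rewrite /ahead.
have [h|h|e] := ltngtP (b j) (b i).
- by case/andP=> _ /andP[/eqP e]; rewrite e ltnn in h.
- by case/andP=> /andP[/eqP e]; rewrite e ltnn in h.
rewrite (val_inj e) eqxx /= => h; apply: (@perm_inj _ s); apply/val_inj/eqP.
by rewrite eqn_leq.
Qed.

Definition rivals n H (b : profile n H) (s : 'S_n) (i : 'I_n) : seq 'I_n :=
  sort (ahead b s) [seq j <- enum 'I_n | j != i].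

Lemma mem_rivals n H (b : profile n H) s i j : (j \in rivals b s i) = (j != i).
Proof. by rewrite mem_sort mem_filter mem_enum andbT. Qed.

Lemma size_rivals n H (b : profile n H) s i : size (rivals b s i) = n.-1.
Proof.
rewrite size_sort size_filter (eq_count (a2 := predC (pred1 i))) //.
have := count_predC (pred1 i) (enum 'I_n).
by rewrite count_uniq_mem ?enum_uniq // mem_enum size_enum_ord add1n => /(congr1 predn).
Qed.

Lemma rivals_set_bid n H (b : profile n H) s i a :
  rivals (set_bid b i a) s i = rivals b s i.
Proof.
have bE j : j != i -> set_bid b i a j = b j by rewrite ffunE => /negPf ->.
(* Mapping by the identity turns the claim into one about sorting under two relations, which agree
   on the bidders other than [i]. *)
rewrite -[LHS]map_id -[RHS]map_id /rivals.
rewrite -(@homo_sort_map_in _ _ [pred j | j != i] id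
  (ahead (set_bid b i a) s) (ahead b s)) ?filter_all ?map_id //.
- by move=> j l _ _; apply: ahead_anti.
- by move=> j l l' _ _ _; apply: ahead_trans.
- by move=> j l _ _; apply: ahead_total.
- by move=> j l hj hl; rewrite /ahead !bE.
Qed.

(** Reading the bids along the ranking gives a decreasing rearrangement of the same bids, so the
    tie-breaking does not affect the k-th entry. *)
Lemma kth_other_rivals n H k i (b : profile n H) s (x0 : 'I_n) :
  (0 < k < n)%N -> kth_other k i b = b (nth x0 (rivals b s i) k.-1).
Proof.
move=> /andP[k0 kn]; rewrite /kth_other.
have -> : sort geq [seq val (b j) | j <- enum 'I_n & j != i]
    = [seq val (b j) | j <- rivals b s i].
  apply: (@sorted_eq _ geq).
  - by move=> x y z /= h1 h2; apply: leq_trans h2 h1.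
  - by move=> x y /=; rewrite andbC => h; apply/eqP; rewrite eqn_leq.
  - by apply: sort_sorted => x y; apply: leq_total.
  - rewrite sorted_map; apply: (sub_sorted (e := ahead b s)); last first.
      exact/sort_sorted/ahead_total.
    move=> j l /=; rewrite /ahead => /orP[/ltnW //|/andP[/eqP -> _]].
    exact: leqnn.
  - apply: perm_trans (permEl (perm_sort _ _)) _.
    by apply: perm_map; rewrite perm_sym; apply: permEl (perm_sort _ _).
by rewrite (nth_map x0) // size_rivals; lia.
Qed.

(* [rivals b s i] does not depend on the bid of [i], so this isolates the
   dependence of the utility on her own bid in the condition [ahead]. *)
Lemma utility_rivals (R : realType) n H k (p : nat -> R) (b : profile n H) s i v :
  (k < n)%N ->
  utility k p b s i v =
  \sum_(1 <= j < k.+1 | ahead b s i (nth i (rivals b s i) j.-1))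
    (p j - p j.+1) * (grid R v - grid R (b (nth i (rivals b s i) j.-1))).
Proof.
move=> kn; rewrite /utility /position /ranked_bid.
have rE : rivals b s i = [seq j <- standing b s | j != i].
  by rewrite filter_sort //; [exact: ahead_total | exact: ahead_trans].
have sz := size_rivals b s i.
have st : sorted (ahead b s) (standing b s) by apply/sort_sorted/ahead_total.
have un : uniq (standing b s) by rewrite sort_uniq enum_uniq.
have ni : i \in standing b s by rewrite mem_sort mem_enum.
(* Cut the standing at [i]: the rivals are [e1 ++ e2], and [i] is ahead of the j-th of them exactly
   when [size e1 < j]. For these [j] the bid ranked [j + 1] is that of the j-th rival, since [i]
   herself occupies an earlier place. *)
have [e1 [e2 sE]] : exists e1 e2 : seq 'I_n, standing b s = e1 ++ i :: e2.
  by case/splitPr: ni => e1 e2; exists e1, e2.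
rewrite {}rE in sz *; rewrite {}sE in st un sz *; move: st un sz.
rewrite sorted_pairwise; last exact: ahead_trans.
rewrite pairwise_cat allrel_consr /= => /and3P[/andP[a1 _] _ /andP[a2 _]].
rewrite cat_uniq /= negb_or => /and3P[_ /andP[ni1 _] /andP[ni2 _]].
have f1 : [seq j <- e1 | j != i] = e1.
  by apply/all_filterP/allP => j hj; apply: contraNneq ni1 => <-.
have f2 : [seq j <- e2 | j != i] = e2.
  by apply/all_filterP/allP => j hj; apply: contraNneq ni2 => <-.
rewrite filter_cat /= eqxx /= f1 f2 size_cat => sz.
rewrite index_cat (negPf ni1) /= eqxx addn0.
have aheadE j : (1 <= j < k.+1)%N ->
    ahead b s i (nth i (e1 ++ e2) j.-1) = (size e1 < j)%N.
  move=> jk; rewrite nth_cat; case: ltnP => h.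
    have hx := mem_nth i h.
    have -> : (size e1 < j)%N = false by lia.
    apply: contraNF ni1 => ha; rewrite (_ : i = nth i e1 j.-1) //.
    by apply: (@ahead_anti _ _ b s); rewrite ha (allP a1).
  have -> : (size e1 < j)%N by lia.
  have hj : (j.-1 - size e1 < size e2)%N by lia.
  exact/(allP a2)/mem_nth.
rewrite [RHS]big_mkcond /=; under [RHS]eq_big_nat => j /aheadE -> do [].
have [h|h] := leqP (size e1).+1 k.+1; last first.
  rewrite big_geq 1?ltnW // big1_seq // => j; rewrite mem_index_iota => hj.
  by case: ifP => //; lia.
rewrite [RHS](big_cat_nat _ h) //= [X in _ = X + _]big1_seq ?add0r; last first.
  by move=> j; rewrite mem_index_iota => hj; case: ifP => //; lia.
apply: eq_big_nat => j hj; rewrite ifT; last lia.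
congr (_ * (_ - _)).
rewrite (nth_map i); last by rewrite size_cat /=; lia.
rewrite !nth_cat; have -> : (j < size e1)%N = false by lia.
have -> : (j.-1 < size e1)%N = false by lia.
by have -> : (j - size e1 = (j.-1 - size e1).+1)%N by lia.
Qed.

(** * Costly rounds and the reward lost by an untruthful bid *)

(** For [a < v] bidder [i] has the last priority, so bid [a] loses the tie at [a] that bid [v]
    avoids. For [a > v] she has the first priority, so bid [a] wins against a bid above her value.
    An extreme priority settles the tie whatever the priorities of the rivals. *)
Definition costly n H k (i : 'I_n) (v a : 'I_H) (o : round n H) : bool :=
  (kth_other k i (bids o) == a)
  && (val (priority o i) == (if (a < v)%N then n.-1 else 0)%N).

Lemma grid_lt (R : realType) H (a v : 'I_H) :
  (a < v)%N -> H%:R^-1 <= grid R v - grid R a.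
Proof.
move=> av; have H0 : (0 < H)%N by apply: leq_ltn_trans (ltn_ord v).
rewrite /grid -mulrBl -[X in X <= _]mul1r ler_wpM2r ?invr_ge0 ?ler0n //.
by rewrite -natrB ?ltnS 1?ltnW // ler1n subn_gt0.
Qed.

Lemma grid_le (R : realType) H (a v : 'I_H) :
  (a <= v)%N -> grid R a <= grid R v.
Proof.
by move=> av; rewrite /grid ler_wpM2r ?invr_ge0 ?ler0n // ler_nat.
Qed.

(** The sums of [utility_rivals] are compared term by term: bid [v] collects every term with
    [c_j < v] and none with [c_j > v]. In a costly round the term [j = k] alone yields the gap, as
    [v] and [a] differ by at least [1 / H]. *)
Lemma truthful_reward_gap (R : realType) n H k (p : nat -> R) rho i
    (o : round n H) (v a : 'I_H) :
  (0 < k < n)%N -> 0 <= rho ->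
  (forall j, (1 <= j <= k)%N -> rho <= p j - p j.+1) -> a != v ->
  reward k p i o a v + rho / H%:R * (costly k i v a o)%:R
    <= reward k p i o v v.
Proof.
move=> /andP[k0 kn] rho0 gap av; rewrite /reward !utility_rivals // !rivals_set_bid.
case: o => [[x b] s]; rewrite /costly /bids /priority /=.
set r := rivals b s i; rewrite (kth_other_rivals i b s i) ?k0 // -/r.
have ri j : (1 <= j < k.+1)%N -> nth i r j.-1 != i.
  by move=> hj; rewrite -(mem_rivals b s i) mem_nth // size_rivals; lia.
have aheadE c j : (1 <= j < k.+1)%N -> ahead (set_bid b i c) s i (nth i r j.-1)
    = (b (nth i r j.-1) < c)%N || ((c == b (nth i r j.-1)) && (s i <= s (nth i r j.-1))%N).
  by move=> /ri hj; rewrite /ahead !ffunE eqxx (negPf hj).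
pose gain c j : R := (p j - p j.+1) * (grid R v - grid R (b (nth i r j.-1)))
  * ((b (nth i r j.-1) < c)%N || ((c == b (nth i r j.-1)) && (s i <= s (nth i r j.-1))%N))%:R.
have sumE c : \sum_(1 <= j < k.+1 | ahead (set_bid b i c) s i (nth i r j.-1))
    (p j - p j.+1) * (grid R v - grid R (set_bid b i c (nth i r j.-1)))
    = \sum_(1 <= j < k.+1) gain c j.
  rewrite big_mkcond; apply: eq_big_nat => j hj; rewrite /gain aheadE //.
  rewrite ffunE (negPf (ri j hj)).
  by case: ifP; rewrite ?mulr1 ?mulr0.
have gain_mono j : (1 <= j < k.+1)%N -> gain a j <= gain v j.
  move=> hj; rewrite /gain; have := gap j hj; set q := p j - p j.+1 => hq.
  have q0 : 0 <= q by apply: le_trans hq.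
  set c := b _; have [cv|vc|/val_inj ->] := ltngtP c v; last by rewrite subrr mulr0 !mul0r.
  - rewrite /= ler_wpM2l ?ler_nat ?leq_b1 // mulr_ge0 // subr_ge0.
    exact/grid_le/ltnW.
  - rewrite /= mulr0 mulr_le0_ge0 // mulr_ge0_le0 // subr_le0.
    exact/grid_le/ltnW.
rewrite !sumE !big_nat_recr //= -addrA lerD //.
  by apply: ler_sum_nat => j hj; apply: gain_mono; lia.
have kk : (1 <= k < k.+1)%N by rewrite k0 leqnn.
case: (boolP (_ && _)) => [|_]; last by rewrite mulr0 addr0 gain_mono.
rewrite mulr1 => /andP[/eqP/val_inj ca /eqP ps].
have hq := gap k kk; rewrite /gain ca; set q := p k - p k.+1 in hq *.
have Hge0 : 0 <= H%:R^-1 :> R by rewrite invr_ge0 ler0n.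
have [va|va|/val_inj e] := ltngtP a v; last by rewrite e eqxx in av.
(* Case [a < v]: with the last priority, bid [a] misses the k-th term, which bid [v] collects. *)
- rewrite va in ps; rewrite ltnn eqxx /=.
  have -> : (s i <= s (nth i r k.-1))%N = false.
    apply/negbTE; rewrite -ltnNge; have h1 := ltn_ord (s (nth i r k.-1)).
    have : s (nth i r k.-1) != s i :> nat.
      by apply/eqP => /val_inj/perm_inj e; have := ri k kk; rewrite e eqxx.
    by move: ps => /=; lia.
  rewrite mulr0 add0r mulr1; apply: ler_pM => //; exact: grid_lt.
(* Case [a > v]: with the first priority, bid [a] wins a term that is at most [- rho / H], and bid
   [v] does not. *)
- rewrite (ltnNge a) (ltnW va) /= in ps.
  rewrite ltnn eqxx ps leq0n /= mulr0 mulr1.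
  have h : rho * H%:R^-1 <= q * (grid R a - grid R v).
    by apply: ler_pM => //; exact: grid_lt.
  by move: h; rewrite -[grid R v - _]opprB mulrN addrC subr_le0.
Qed.

(** * The law of one round given the history *)

Lemma prod_sum_profiles (R : realType) n H (W : 'I_n -> 'I_H -> 'I_H -> R) :
  \sum_(x : profile n H) \sum_(b : profile n H) \prod_j W j (x j) (b j)
  = \prod_j \sum_x \sum_y W j x y.
Proof.
rewrite bigA_distr_bigA; apply: eq_bigr => x _.
by rewrite (bigA_distr_bigA (fun j y => W j (x j) y)).
Qed.

Lemma sum_rounds (R : realType) n H (G : round n H -> R) :
  \sum_o G o = \sum_x \sum_b \sum_s G (x, b, s).
Proof.
rewrite (eq_bigr (fun o => G (o.1, o.2))); last by case.
rewrite -(pair_big xpredT xpredT (fun a s => G (a, s))) /=.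
rewrite (eq_bigr (fun a => \sum_s G ((a.1, a.2), s))); last by case.
by rewrite -(pair_big xpredT xpredT (fun x b => \sum_s G ((x, b), s))).
Qed.

(** Composing with the transposition of [c] and [c'] matches the orders sending [i] to [c] with
    those sending [i] to [c'], so the [n] classes have equal size. *)
Lemma card_perm_at n (i c : 'I_n) :
  (n * \sum_(s : 'S_n | s i == c) 1 = n`!)%N.
Proof.
have eqc c' : (\sum_(s : 'S_n | s i == c') 1 = \sum_(s : 'S_n | s i == c) 1)%N.
  rewrite (reindex_inj (mulIg (tperm c c'))); apply: eq_bigl => s.
  by rewrite permM -[X in _ == X](tpermL c c') (inj_eq perm_inj).
rewrite -(card_Sn n) -[in RHS]sum1_card.
rewrite [RHS](partition_big (fun s : 'S_n => s i) xpredT) //=.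
rewrite [RHS](eq_bigr (fun=> \sum_(s : 'S_n | s i == c) 1)%N) => [|c' _].
  by rewrite [RHS]sum_nat_const card_ord.
by rewrite -(eqc c'); apply: eq_bigl.
Qed.

Section RoundLaw.
Variables (R : realType) (n H : nat) (F : 'I_n -> 'I_H -> R).
Variables (alg : 'I_n -> learner R (round n H) 'I_H 'I_H).
Variable h : seq (round n H).
Hypothesis F_pmf : forall i, is_pmf (F i).
Hypothesis alg_pmf : forall i c, is_pmf (alg i h c).

Lemma round_law_ge0 o : 0 <= round_law F alg h o.
Proof.
rewrite divr_ge0 ?ler0n // prodr_ge0 // => j _.
by rewrite mulr_ge0 //; [case: (F_pmf j) | case: (alg_pmf j (values o j))].
Qed.

Lemma round_law_sum (c : profile n H -> profile n H -> R) (e : 'S_n -> R) :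
  \sum_o round_law F alg h o * (c (values o) (bids o) * e (priority o)) =
  (\sum_(x : profile n H) \sum_(b : profile n H)
     (\prod_j (F j (x j) * alg j h (x j) (b j))) * c x b)
  * ((\sum_s e s) / n`!%:R).
Proof.
rewrite sum_rounds mulr_suml; apply: eq_bigr => x _.
rewrite mulr_suml; apply: eq_bigr => b _.
rewrite mulr_suml mulr_sumr; apply: eq_bigr => s _.
by rewrite /round_law /values /bids /priority /=; ring.
Qed.

Lemma round_law_marginal i v a :
  \sum_o round_law F alg h o * ((values o i == v) && (bids o i == a))%:R
  = F i v * alg i h v a.
Proof.
(* The indicator is moved into the factor of bidder [i]. The weight is then a product over bidders
   in which every other factor sums to 1. *)
pose W j x y := F j x * alg j h x y
  * (if j == i then ((x == v) && (y == a))%:R else 1).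
under eq_bigr do rewrite -[X in _ * X]mulr1.
rewrite (round_law_sum (fun x b => ((x i == v) && (b i == a))%:R) (fun=> 1)).
rewrite sumr_const card_Sn divff ?pnatr_eq0 -?lt0n ?fact_gt0 // mulr1.
transitivity (\sum_(x : profile n H) \sum_(b : profile n H)
    \prod_j W j (x j) (b j)).
  apply: eq_bigr => x _; apply: eq_bigr => b _; rewrite [RHS]big_split /=.
  congr (_ * _); rewrite (bigD1 i) //= eqxx big1 ?mulr1 // => j.
  by move=> /negPf ->.
rewrite prod_sum_profiles (bigD1 i) //= [X in _ * X]big1 ?mulr1 => [|j ji].
  rewrite (bigD1 v) //= [X in _ + X]big1 ?addr0 => [|x xv].
    rewrite (bigD1 a) //= [X in _ + X]big1 ?addr0 => [|y ya].
      by rewrite /W !eqxx mulr1.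
    by rewrite /W eqxx (negPf ya) andbF mulr0.
  by rewrite big1 // => y _; rewrite /W eqxx (negPf xv) mulr0.
have [_ F1] := F_pmf j; rewrite -[RHS]F1; apply: eq_bigr => x _.
have [_ A1] := alg_pmf j x; rewrite -[RHS]mulr1 -[in RHS]A1 mulr_sumr.
by apply: eq_bigr => y _; rewrite /W (negPf ji) mulr1.
Qed.

Lemma round_law_values i v :
  \sum_o round_law F alg h o * (values o i == v)%:R = F i v.
Proof.
have [_ alg1] := alg_pmf i v; rewrite -[RHS]mulr1 -[in RHS]alg1 mulr_sumr.
under [RHS]eq_bigr do rewrite -round_law_marginal.
rewrite exchange_big; apply: eq_bigr => o _ /=.
rewrite -mulr_sumr (bigD1 (bids o i)) //= eqxx andbT big1 ?addr0 // => a.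
by rewrite eq_sym => /negPf ->; rewrite andbF.
Qed.

Lemma round_law_total (i : 'I_n) : \sum_o round_law F alg h o = 1.
Proof.
have [_ F1] := F_pmf i; rewrite -[RHS]F1; under [RHS]eq_bigr do rewrite -round_law_values.
rewrite exchange_big; apply: eq_bigr => o _ /=.
rewrite -mulr_sumr (bigD1 (values o i)) //= eqxx big1 ?addr0 ?mulr1 // => v.
by rewrite eq_sym => /negPf ->.
Qed.

Let kth_bid_mass k i (a : 'I_H) : R :=
  \sum_(x : profile n H) \sum_(b : profile n H)
    (\prod_j (F j (x j) * alg j h (x j) (b j))) * (kth_other k i b == a)%:R.

(** The priority order is independent of the bids, and a costly round prescribes one rank for [i],
    whence the factor [1 / n]. *)
Lemma costly_mass k i v a :
  \sum_o round_law F alg h o * (costly k i v a o)%:R = kth_bid_mass k i a / n%:R.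
Proof.
have n0 : (0 < n)%N by apply: leq_ltn_trans (ltn_ord i).
have cn : ((if (a < v)%N then n.-1 else 0) < n)%N by case: ifP => _; lia.
pose c := Ordinal cn.
have -> : kth_bid_mass k i a / n%:R = kth_bid_mass k i a
    * ((\sum_(s : 'S_n) (s i == c)%:R) / n`!%:R).
  have nz : n%:R != 0 :> R by rewrite pnatr_eq0 -lt0n.
  have fz : n`!%:R != 0 :> R by rewrite pnatr_eq0 -lt0n fact_gt0.
  have -> : \sum_(s : 'S_n) (s i == c)%:R
      = (\sum_(s : 'S_n | s i == c) 1)%N%:R :> R.
    by rewrite natr_sum [RHS]big_mkcond; apply: eq_bigr => s _; case: (s i == c).
  have := card_perm_at i c; set m := (\sum_(_ | _) 1)%N => nm.
  have := congr1 (fun z => z%:R : R) nm; rewrite /= natrM => <-.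
  have mz : m%:R != 0 :> R.
    by rewrite pnatr_eq0; apply/eqP => e; move: (fact_gt0 n); rewrite -nm e muln0.
  by field; apply/andP.
rewrite -round_law_sum; apply: eq_bigr => o _.
by rewrite /costly -natrM mulnb.
Qed.

(** Every bid profile has mass [H^-n], and in the [H] profiles where all others bid [a] the k-th
    largest other bid is [a]. This produces [1 / H^(n-1)], the quantity assumed to dominate
    [tau]. *)
Lemma costly_mass_exploration k i v a :
  (0 < k < n)%N -> (forall j x y, alg j h x y = H%:R^-1) ->
  1 / H%:R ^+ n.-1 / n%:R <= \sum_o round_law F alg h o * (costly k i v a o)%:R.
Proof.
move=> kn unif; rewrite costly_mass ler_wpM2r ?invr_ge0 ?ler0n //.
have Hz : H%:R != 0 :> R.
  by rewrite pnatr_eq0 -lt0n (leq_ltn_trans _ (ltn_ord v)).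
have -> : kth_bid_mass k i a
    = H%:R ^- n * (\sum_(b : profile n H) (kth_other k i b == a))%N%:R.
  rewrite /kth_bid_mass exchange_big natr_sum mulr_sumr; apply: eq_bigr => b _ /=.
  rewrite -mulr_suml; congr (_ * _).
  rewrite -(bigA_distr_bigA (fun j y => F j y * alg j h y (b j))) -exprVn.
  rewrite -[n in RHS]card_ord -prodr_const; apply: eq_bigr => j _.
  under eq_bigr do rewrite unif.
  by rewrite -mulr_suml; have [_ ->] := F_pmf j; rewrite mul1r.
have n0 : (0 < n)%N by lia.
have -> : 1 / H%:R ^+ n.-1 = H%:R ^- n * H%:R :> R.
  by rewrite -{2}(prednK n0) exprS; field; rewrite Hz expf_neq0.
rewrite ler_wpM2l ?invr_ge0 ?exprn_ge0 ?ler0n // ler_nat.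
pose b0 : profile n H := [ffun=> a].
have inj : injective (set_bid b0 i).
  by move=> x y /ffunP/(_ i); rewrite !ffunE eqxx.
have -> : (\sum_(b : profile n H) (kth_other k i b == a))%N
    = #|[pred b : profile n H | kth_other k i b == a]|.
  by rewrite -sum1_card [RHS]big_mkcond; apply: eq_bigr => b _; rewrite inE; case: eqP.
rewrite -[H in (H <= _)%N]card_ord -(card_codom inj).
apply/subset_leq_card/fintype.subsetP => b /codomP[y ->]; rewrite inE.
rewrite (kth_other_rivals i _ 1%g i) // rivals_set_bid.
have ri : nth i (rivals b0 1%g i) k.-1 != i.
  by rewrite -(mem_rivals b0 1%g i) mem_nth // size_rivals; lia.
by rewrite !ffunE (negPf ri).
Qed.

(** Only the outcomes where everybody bids her value are kept; there the k-th largest other bid is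
    the k-th largest other value. Given the values, this has probability at least
    [(1 - e)^n >= 1 - n e]. *)
Lemma costly_mass_truthful k i v a e :
  (forall j x, 1 - e <= alg j h x x) -> 0 <= e <= 1 ->
  (1 - n%:R * e) * kth_other_pmf k F i a / n%:R
    <= \sum_o round_law F alg h o * (costly k i v a o)%:R.
Proof.
move=> truth /andP[e0 e1]; rewrite costly_mass ler_wpM2r ?invr_ge0 ?ler0n //.
rewrite /kth_other_pmf mulr_sumr big_mkcond; apply: ler_sum => x _.
have F0 j y : 0 <= F j y by case: (F_pmf j).
have A0 j y z : 0 <= alg j h y z by case: (alg_pmf j y).
have P0 b : 0 <= \prod_j (F j (x j) * alg j h (x j) (b j)).
  by apply: prodr_ge0 => j _; rewrite mulr_ge0.
rewrite (bigD1 x) //=; apply: ler_wpDr.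
  by apply: sumr_ge0 => b _; rewrite mulr_ge0.
case: ifP => _; last by rewrite mulr0.
rewrite mulr1 big_split /= mulrC ler_wpM2l ?prodr_ge0 //.
apply: (@le_trans _ _ (\prod_(j < n) (1 - e))); last first.
  by apply: ler_prod => j _; rewrite subr_ge0 e1 truth.
(* Bernoulli's inequality, by induction on the number of factors. *)
rewrite prodr_const card_ord; elim: (n) => [|m IH]; first by rewrite mul0r subr0.
rewrite exprS; apply: (@le_trans _ _ ((1 - e) * (1 - m%:R * e))).
  rewrite -natr1 -subr_ge0.
  have -> : (1 - e) * (1 - m%:R * e) - (1 - (m%:R + 1) * e) = m%:R * e * e by ring.
  by rewrite !mulr_ge0.
by rewrite ler_wpM2l // subr_ge0.
Qed.

End RoundLaw.

(** * Averages over future histories, and their link with the process *)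

Section Process.
Variables (R : realType) (n H : nat) (F : 'I_n -> 'I_H -> R).
Variables (alg : 'I_n -> learner R (round n H) 'I_H 'I_H).

(** The expectation of [f] at the history reached [m] rounds after [h]. As a finite recursion it
    lets supermartingale arguments run by induction on [m], without conditional expectations. *)
Fixpoint after (m : nat) (h : seq (round n H)) (f : seq (round n H) -> R) : R :=
  if m is m'.+1 then \sum_o round_law F alg h o * after m' (rcons h o) f
  else f h.

(** The recursion peels off the first round; path probabilities and events of a single round require
    peeling off the last. *)
Lemma after_last m h f :
  after m.+1 h f
  = after m h (fun h' => \sum_o round_law F alg h' o * f (rcons h' o)).
Proof.
elim: m h => [//|m IH] h; rewrite [LHS]/= [RHS]/=; apply: eq_bigr => o _.
by rewrite -IH.
Qed.

Lemma eq_after m h f g : f =1 g -> after m h f = after m h g.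
Proof.
by move=> fg; elim: m h => [|m IH] h /=; [|apply: eq_bigr => o _; rewrite IH].
Qed.

Lemma afterZ m h c f : after m h (fun h' => c * f h') = c * after m h f.
Proof.
elim: m h => [//|m IH] h /=; rewrite mulr_sumr; apply: eq_bigr => o _.
by rewrite IH mulrCA.
Qed.

Hypothesis F_pmf : forall i, is_pmf (F i).
Hypothesis alg_pmf : forall i h c, is_pmf (alg i h c).

Lemma after_const (i : 'I_n) m h c : after m h (fun=> c) = c.
Proof.
elim: m h => [//|m IH] h /=; under eq_bigr do rewrite IH.
by rewrite -mulr_suml (round_law_total F_pmf _ i) ?mul1r.
Qed.

Variables (d : measure_display) (Omega : measurableType d).
Variables (P : probability Omega R) (X : nat -> Omega -> round n H).
Hypothesis X_process : auction_process P F alg X.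

Lemma historyS t w : history X t.+1 w = rcons (history X t w) (X t.+1 w).
Proof. by rewrite /history -[in iota 1 t.+1](addn1 t) iotaD map_cat cats1 add1n. Qed.

Arguments history : simpl never.

Lemma size_history t w : size (history X t w) = t.
Proof. by rewrite size_map size_iota. Qed.

Lemma measurable_history t h : measurable [set w | history X t w = h].
Proof.
elim: t h => [|t IH] h.
  have [->|hn] := eqVneq h [::].
    by rewrite (_ : [set w | _] = setT) //; apply/seteqP; split.
  rewrite (_ : [set w | _] = set0) //; apply/seteqP; split => // w /= e.
  by rewrite -e eqxx in hn.
case: (lastP h) => [|h' o].
  by rewrite (_ : [set w | _] = set0) //; apply/seteqP; split.
rewrite (_ : [set w | _] = [set w | history X t w = h'] `&` [set w | X t.+1 w = o]).
  by apply: measurableI; [exact: IH | case: X_process].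
apply/seteqP; split => w /=; rewrite historyS.
  by move=> /rcons_inj[].
by case=> -> ->.
Qed.

Let path_mass t h : R := fine (P [set w | history X t w = h]).

Lemma path_massS t h o : size h = t ->
  path_mass t.+1 (rcons h o) = path_mass t h * round_law F alg h o.
Proof.
move=> sh; rewrite /path_mass.
rewrite (_ : [set w | _] = [set w | history X t w = h /\ X t.+1 w = o]); last first.
  apply/seteqP; split => w /=; rewrite historyS; first by move=> /rcons_inj[].
  by case=> -> ->.
case: X_process => _ /(_ t h o sh) ->.
by rewrite fineM ?fin_num_measure //; exact: measurable_history.
Qed.

Lemma after_path_mass t f :
  after t [::] f = \sum_(h : t.-tuple (round n H)) f h * path_mass t h.
Proof.
elim: t f => [|t IH] f.
  rewrite (big_pred1 [tuple]) => [|h]; last by apply/esym/eqP/tuple0.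
  rewrite /path_mass (_ : [set w | _] = setT); last by apply/seteqP; split.
  by rewrite probability_setT mulr1.
rewrite after_last IH.
(* Appending the last round is a bijection onto the paths of length [t.+1], being injective between
   sets of equal cardinality. *)
pose snoc (u : t.-tuple (round n H) * round n H) : t.+1.-tuple (round n H) :=
  [tuple of rcons u.1 u.2].
have snoc_inj : injective snoc.
  by move=> [h o] [h' o'] /(congr1 val)/= /rcons_inj[/val_inj -> ->].
rewrite [RHS](reindex snoc) /=; last first.
  apply/onW_bij/inj_card_bij => //.
  by rewrite card_prod !card_tuple expnS mulnC.
rewrite -(pair_big xpredT xpredT
  (fun h o => f (rcons (val h) o) * path_mass t.+1 (rcons (val h) o))) /=.
apply: eq_bigr => h _; rewrite mulr_suml; apply: eq_bigr => o _.
by rewrite path_massS ?size_tuple //; ring.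
Qed.

(** A history of given length takes finitely many values, so the integrand is a finite combination
    of indicators, integrated term by term thanks to nonnegativity. *)
Lemma expectation_history t f : (forall h, 0 <= f h) ->
  ('E_P[fun w => f (history X t w)] = (after t [::] f)%:E)%E.
Proof.
move=> f0; rewrite after_path_mass unlock.
pose A (h : t.-tuple (round n H)) := [set w | history X t w = h].
rewrite (eq_integral (fun w => \sum_(h : t.-tuple (round n H))
    ((f h)%:E * (\1_(A h) w)%:E)%E)%R); last first.
  move=> w _; have sh : size (history X t w) == t by rewrite size_history.
  rewrite (bigD1 (Tuple sh)) //= big1 ?adde0 => [|h hn].
    by rewrite indicE mem_set ?mule1.
  rewrite indicE memNset ?mule0 //= => e; case/eqP: hn.
  exact/val_inj.
rewrite ge0_integral_sum //; last 2 first.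
- by move=> h; apply: measurable_funeM; apply/measurable_EFinP/measurable_indic/measurable_history.
- by move=> h w _; rewrite mule_ge0 ?lee_fin ?indicE ?ler0n.
rewrite -sumEFin; apply: eq_bigr => h _.
rewrite ge0_integralZl ?lee_fin //.
- rewrite integral_indic ?setIT //; last exact: measurable_history.
  by rewrite EFinM /path_mass fineK ?fin_num_measure //; exact: measurable_history.
- exact/measurable_EFinP/measurable_indic/measurable_history.
Qed.

Lemma prob_round t (g : pred (round n H)) :
  P [set w | g (X t.+1 w)]
  = (after t [::] (fun h => \sum_o round_law F alg h o * (g o)%:R))%:E.
Proof.
(* The round is read off as the last entry of a history of length [t.+1]; the value 0 at the empty
   history is only a default. *)
pose last_ok (h : seq (round n H)) : R :=
  if h is o :: h' then (g (last o h'))%:R else 0.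
have last_rcons h o : last_ok (rcons h o) = (g o)%:R.
  by case: h => [//|o' h] /=; rewrite last_rcons.
have mg : measurable [set w | g (X t.+1 w)].
  rewrite (_ : [set w | _] = \bigcup_(o in [set` g]) [set w | X t.+1 w = o]).
    by apply: fin_bigcup_measurable => // o _; case: X_process.
  by apply/seteqP; split => w /=; [exists (X t.+1 w) | case=> o go ->].
transitivity ('E_P[fun w => last_ok (history X t.+1 w)])%E.
  rewrite unlock -[X in P X = _]setIT -integral_indic //; apply: eq_integral => w _.
  rewrite indicE historyS last_rcons; congr ((nat_of_bool _)%:R%:E).
  by apply/idP/idP; rewrite inE.
rewrite expectation_history; last by case=> [|o h] /=; rewrite ?ler0n.
congr (_%:E); rewrite after_last.
apply: eq_after => h.
by apply: eq_bigr => o _; rewrite last_rcons.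
Qed.

(** The value is independent of the past, so [F i v] factors out of the joint probability and
    cancels. *)
Lemma cond_prob_bid_law t i v a : 0 < F i v ->
  cond_prob P [set w | bids (X t.+1 w) i = a] [set w | values (X t.+1 w) i = v]
  = bid_law_given P alg X i t.+1 v a.
Proof.
move=> Fv; rewrite /bid_law_given /= (expectation_history t (f := fun h => alg i h v a)); last first.
  by move=> h; case: (alg_pmf i h v).
rewrite /cond_prob.
rewrite (_ : _ `&` _ = [set w | (values (X t.+1 w) i == v) && (bids (X t.+1 w) i == a)]); last first.
  apply/seteqP; split => w /=; first by move=> [-> ->]; rewrite !eqxx.
  by move=> /andP[/eqP -> /eqP ->].
rewrite (_ : [set w | values _ i = v] = [set w | values (X t.+1 w) i == v]); last first.
  by apply/seteqP; split => w /= /eqP.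
rewrite (prob_round t (fun o => (values o i == v) && (bids o i == a))).
rewrite (prob_round t (fun o => values o i == v)) /=.
under eq_after do rewrite round_law_marginal //.
under [X in _ / X]eq_after do rewrite round_law_values //.
by rewrite after_const // afterZ mulrC mulKf // gt_eqF.
Qed.

End Process.

(** * Mean-based learning and the exponential supermartingale *)

Lemma expRN1_le (R : realType) : expR (- 1) <= 1 / 2 :> R.
Proof.
rewrite expRN -div1r ler_pdivrMr ?expR_gt0 //.
have := expR_ge1Dx (1 : R); lra.
Qed.

Section Truthfulness.
Variables (R : realType) (n k H : nat) (p : nat -> R) (rho : R).
Variables (F : 'I_n -> 'I_H -> R) (gamma : nat -> R) (T0 : nat) (tau : R).
Variable alg : 'I_n -> learner R (round n H) 'I_H 'I_H.
Hypotheses (k_range : (0 < k < n)%N) (H_gt0 : (0 < H)%N) (T0_gt0 : (0 < T0)%N).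
Hypotheses (rho_gt0 : 0 < rho) (rho_le1 : rho <= 1).
Hypothesis p_gap : forall j, (1 <= j <= k)%N -> rho <= p j - p j.+1.
Hypothesis F_pmf : forall i, is_pmf (F i).
Hypothesis alg_bidding : forall i, bidding_algorithm k p gamma T0 i (alg i).
Hypotheses (tau_gt0 : 0 < tau) (tau_le : tau <= 1 / H%:R ^+ n.-1).
Hypothesis thickness : forall i v, tau <= kth_other_pmf k F i v.
Hypothesis gamma_small : forall t, (T0 <= t)%N ->
  gamma t <= tau * rho / (8 * n%:R * H%:R).

Let alg_pmf i h c : is_pmf (alg i h c).
Proof. by case: (alg_bidding i). Qed.

Let n_gt0N : (0 < n)%N.
Proof. by case/andP: k_range => _; apply: leq_ltn_trans. Qed.

Let n_gt0 : 0 < n%:R :> R.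
Proof. by rewrite ltr0n. Qed.

Let nz : n%:R != 0 :> R.
Proof. by rewrite gt_eqF. Qed.

Let Hz : H%:R != 0 :> R.
Proof. by rewrite gt_eqF ?ltr0n. Qed.

Let rhoz : rho != 0.
Proof. by rewrite gt_eqF. Qed.

Lemma tau_le1 : tau <= 1.
Proof.
apply: (le_trans tau_le); rewrite ler_pdivrMr ?mul1r ?exprn_gt0 ?ltr0n //.
by rewrite exprn_ege1 // ler1n.
Qed.

Definition hits (i : 'I_n) (v a : 'I_H) (h : seq (round n H)) : nat :=
  count (costly k i v a) h.

(* A bidder, value and bid for which the guaranteed gap no longer beats the
   slack of the mean-based algorithm. *)
Definition stalled (h : seq (round n H)) : bool :=
  (T0 <= size h)%N && [exists i, exists v, exists a,
    rho / H%:R * (hits i v a h)%:R <= gamma (size h) * (size h)%:R].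

Lemma cumulative_gap i v a h : a != v ->
  Defs.cumulative (reward k p i) h a v + rho / H%:R * (hits i v a h)%:R
    <= Defs.cumulative (reward k p i) h v v.
Proof.
move=> av; rewrite /Defs.cumulative /hits -sum1_count natr_sum mulr_sumr [X in _ + X]big_mkcond.
rewrite -big_split /=; apply: ler_sum => o _ /=.
have := truthful_reward_gap i o k_range (ltW rho_gt0) p_gap av.
by case: (costly k i v a o); rewrite ?mulr0.
Qed.

(** Taking twice the same action, a negative [gamma t] would meet the premise of the mean-based
    condition for any history of length [t > 0], and bound a probability by a negative number. *)
Lemma gamma_ge0 (i : 'I_n) (v : 'I_H) t : (T0 <= t)%N -> 0 <= gamma t.
Proof.
move=> tT; rewrite leNgt; apply/negP => g0.
pose h : seq (round n H) := nseq t ([ffun=> v], [ffun=> v], 1%g).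
have sh : size h = t by rewrite size_nseq.
have [alg1 _ /(_ h v v v)] := alg_bidding i; rewrite sh => /(_ tT) mb.
have [/(_ v) A0 _] := alg1 h v.
have : alg i h v v <= gamma t.
  apply: mb; rewrite ltrBrDl gtrDr nmulr_rlt0 // ltr0n.
  exact: leq_trans T0_gt0 tT.
by move=> /(le_trans A0); rewrite leNgt g0.
Qed.

(** Each of the [H - 1] other bids trails [v] by more than the slack, so it is played with
    probability at most [gamma]. *)
Lemma truthful_unless_stalled i v h : (T0 <= size h)%N -> ~~ stalled h ->
  1 - H.-1%:R * gamma (size h) <= alg i h v v.
Proof.
move=> sT; rewrite /stalled sT /= => nst.
have [A0 A1] := alg_pmf i h v.
rewrite lerBlDr -[X in X <= _]A1 (bigD1 v) //= lerD2l.
apply: (@le_trans _ _ (\sum_(a < H | a != v) gamma (size h))); last first.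
  by rewrite sumr_const cardC1 card_ord mulr_natl.
apply: ler_sum => a av; case: (alg_bidding i) => _ _; apply; first exact: sT.
apply: (lt_le_trans _ (lerB (cumulative_gap i h av) (lexx _))).
rewrite -addrA ltrDl subr_gt0 ltNge; apply: contra nst => le_hits.
by apply/existsP; exists i; apply/existsP; exists v; apply/existsP; exists a.
Qed.

(** During the exploration uniform bids give at least [tau / n]. Afterwards the algorithms are
    truthful up to [e = (H - 1) gamma], and [n e <= 1/8] leaves [7/8] of the mass granted by
    thickness. *)
Lemma costly_probability i v a h : ~~ stalled h ->
  7 * tau / (8 * n%:R)
    <= \sum_o round_law F alg h o * (costly k i v a o)%:R.
Proof.
move=> nst; have [sT|sT] := ltnP (size h) T0.
  apply: le_trans (costly_mass_exploration _ _ _ _ _ _) => //.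
    apply: (@le_trans _ _ (tau / n%:R)).
      rewrite -subr_ge0 (_ : _ - _ = tau / (8 * n%:R)); last by field; rewrite ?nz ?Hz.
      by rewrite divr_ge0 ?mulr_ge0 // ltW.
    by rewrite ler_wpM2r // invr_ge0 ltW.
  by move=> j x y; case: (alg_bidding j) => _ ->.
have g0 := gamma_ge0 i v sT; have gs := gamma_small sT.
set e := H.-1%:R * gamma (size h).
have e0 : 0 <= e by rewrite mulr_ge0.
have tr0 : tau * rho <= 1 by rewrite mulr_ile1 ?tau_le1 // ltW.
have ne : n%:R * e <= 1 / 8.
  apply: (@le_trans _ _ (n%:R * (H%:R * gamma (size h)))).
    by rewrite ler_wpM2l ?ler_wpM2r ?ler_nat ?leq_pred // ltW.
  rewrite mulrA mulrC -ler_pdivlMr ?mulr_gt0 ?ltr0n //.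
  apply: (le_trans gs); rewrite ler_pdivrMr ?mulr_gt0 ?ltr0n //.
  apply: (le_trans tr0); rewrite le_eqVlt; apply/orP; left; apply/eqP.
  by field; rewrite ?nz ?Hz ?rhoz.
have e1 : e <= 1.
  have n1 : 1 <= n%:R :> R by rewrite ler1n.
  have : e <= n%:R * e by rewrite ler_peMl.
  by lra.
have truth j x : 1 - e <= alg j h x x by apply: truthful_unless_stalled.
have e01 : 0 <= e <= 1 by rewrite e0 e1.
apply: le_trans (costly_mass_truthful F_pmf (alg_pmf^~ h) k i v a truth e01).
rewrite (_ : 7 * tau / (8 * n%:R) = 7 / 8 * tau / n%:R); last first.
  by field; rewrite ?nz ?Hz.
rewrite ler_wpM2r ?invr_ge0 ?(ltW n_gt0) //; apply: ler_pM => //; first exact: ltW.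
by lra.
Qed.

(** Half of the lower bound on the probability of a costly round. *)
Let kappa : R := 7 * tau / (16 * n%:R).

(** Summing over all bidders, values and bids plays the role of a union bound. *)
Definition potential (h : seq (round n H)) : R :=
  \sum_(z : 'I_n * ('I_H * 'I_H))
    expR (kappa * (size h)%:R - (hits z.1 z.2.1 z.2.2 h)%:R).

Lemma potential_ge0 h : 0 <= potential h.
Proof. by apply: sumr_ge0 => z _; apply: expR_ge0. Qed.

Lemma potential_nil : potential [::] = (n * H ^ 2)%:R.
Proof.
rewrite /potential; under eq_bigr do rewrite mulr0 subr0 expR0.
by rewrite sumr_const !card_prod !card_ord mulnn.
Qed.

(** If a round is costly with probability [m], each summand is multiplied on average by
    [exp kappa (1 - (1 - 1/e) m)]. Since [1 - 1/e >= 1/2] and [kappa <= m / 2], the bracket is at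
    most [1 - kappa <= exp (- kappa)]. *)
Lemma potential_step h : ~~ stalled h ->
  \sum_o round_law F alg h o * potential (rcons h o) <= potential h.
Proof.
move=> nst; under eq_bigr do rewrite mulr_sumr.
rewrite exchange_big; apply: ler_sum => -[i [v a]] _ /=.
have -> : \sum_o round_law F alg h o
      * expR (kappa * (size (rcons h o))%:R - (hits i v a (rcons h o))%:R)
    = expR (kappa * (size h)%:R - (hits i v a h)%:R)
      * (expR kappa * \sum_o (round_law F alg h o
          - (1 - expR (- 1)) * (round_law F alg h o * (costly k i v a o)%:R))).
  rewrite !mulr_sumr; apply: eq_bigr => o _.
  rewrite size_rcons /hits -cats1 count_cat /= addn0 -natr1 natrD.
  rewrite (_ : _ - _ = (kappa * (size h)%:R - (count (costly k i v a) h)%:R)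
      + kappa - (costly k i v a o)%:R); last by ring.
  rewrite !expRD; case: (costly k i v a o); rewrite ?oppr0 ?expR0 /=; ring.
rewrite ger_pMr ?expR_gt0 // sumrB -mulr_sumr.
rewrite (round_law_total F_pmf _ i) //.
have := costly_probability i v a nst; set m := \sum_o _ => hm.
rewrite -ler_pdivlMl ?expR_gt0 // mulr1 -expRN.
apply: le_trans (expR_ge1Dx _).
have := expRN1_le R; set x := expR _ => hx.
have m0 : 0 <= m.
  by apply: le_trans hm; rewrite divr_ge0 ?mulr_ge0 ?ltW.
have : kappa <= m / 2.
  apply: le_trans (ler_wpM2r _ hm) => //; rewrite /kappa le_eqVlt.
  by apply/orP; left; apply/eqP; field; rewrite ?nz ?Hz.
have : m / 2 <= (1 - x) * m by rewrite mulrC ler_wpM2r //; lra.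
lra.
Qed.

(** With [s] rounds played, a stalled triple has at most [tau s / (8 n)] costly rounds, so its
    exponent is at least [(7/16 - 2/16) tau s / n], and [s >= T0]. *)
Lemma potential_stalled h : stalled h ->
  expR (tau * T0%:R / (4 * n%:R)) <= potential h.
Proof.
case/andP=> sT /existsP[i /existsP[v /existsP[a le_hits]]].
rewrite /potential (bigD1 (i, (v, a))) //= ler_wpDr //.
  by apply: sumr_ge0 => z _; apply: expR_ge0.
rewrite ler_expR; set s := (size h)%:R in le_hits *.
have s0 : 0 <= s by [].
have Ts : T0%:R <= s by rewrite ler_nat.
have hits_le : (hits i v a h)%:R <= tau * s / (8 * n%:R).
  rewrite -(ler_pM2l (x := rho / H%:R)) ?divr_gt0 ?ltr0n //.
  apply: (le_trans le_hits); apply: (le_trans (ler_wpM2r s0 (gamma_small sT))).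
  rewrite le_eqVlt; apply/orP; left; apply/eqP.
  by field; rewrite ?nz ?Hz ?rhoz.
have : tau * T0%:R / (4 * n%:R) <= 5 * (tau * s) / (16 * n%:R).
  rewrite (_ : tau * T0%:R / (4 * n%:R) = 4 * (tau * T0%:R) / (16 * n%:R)); last first.
    by field; rewrite ?nz ?Hz.
  rewrite ler_wpM2r ?invr_ge0 ?mulr_ge0 ?(ltW n_gt0) //.
  have := ler_wpM2l (ltW tau_gt0) Ts; have : 0 <= tau * s by rewrite mulr_ge0 // ltW.
  lra.
have -> : 5 * (tau * s) / (16 * n%:R) = kappa * s - tau * s / (8 * n%:R).
  by rewrite /kappa; field; rewrite ?nz ?Hz.
lra.
Qed.

(** Induction on the rounds to come replaces optional stopping. At a stalled history the left side
    is at most 0, since the potential has reached the threshold. Otherwise the average potential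
    does not grow, and once no round is left the mean-based bound applies. *)
Lemma after_truthful i v m h : (T0 <= size h + m)%N ->
  1 - H.-1%:R * gamma (size h + m)
    - potential h / expR (tau * T0%:R / (4 * n%:R))
  <= after F alg m h (fun h' => alg i h' v v).
Proof.
set B := expR _; have B0 : 0 < B by apply: expR_gt0.
have A0 h' : 0 <= alg i h' v v by case: (alg_pmf i h' v).
have L0 h' o : 0 <= round_law F alg h' o by apply: round_law_ge0.
have after_ge0 m' h' : 0 <= after F alg m' h' (fun h' => alg i h' v v).
  by elim: m' h' => //= m' IH h'; apply: sumr_ge0 => o _; rewrite mulr_ge0.
elim: m h => [|m IH] h sT.
all: have Hg0 := mulr_ge0 (ler0n R H.-1) (gamma_ge0 i v sT).
all: have [st|nst] := boolP (stalled h); first (apply: le_trans (after_ge0 _ _);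
  have : 1 <= potential h / B by rewrite ler_pdivlMr ?mul1r ?potential_stalled).
all: try lra.
- rewrite addn0 in sT *; apply: le_trans (truthful_unless_stalled i v sT nst).
  by rewrite gerBl divr_ge0 ?potential_ge0 // ltW.
- rewrite /=; set x := H.-1%:R * gamma (size h + m.+1).
  apply: (@le_trans _ _ (\sum_o round_law F alg h o
      * (1 - x - potential (rcons h o) / B))).
    under eq_bigr do rewrite mulrBr mulrA.
    rewrite sumrB -mulr_suml (round_law_total F_pmf _ i) // mul1r lerD2l lerN2.
    rewrite -mulr_suml.
    by rewrite ler_wpM2r ?potential_step // invr_ge0 ltW.
  apply: ler_sum => o _; rewrite ler_wpM2l //.
  by have := IH (rcons h o); rewrite size_rcons addSnnS; apply.
Qed.

Lemma bid_law_lower (d : measure_display) (Omega : measurableType d)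
    (P : probability Omega R) (X : nat -> Omega -> round n H) i v t :
  auction_process P F alg X -> (T0 <= t)%N ->
  1 - H.-1%:R * gamma t
    - (n * H ^ 2)%:R / expR (tau * T0%:R / (4 * n%:R))
  <= bid_law_given P alg X i t.+1 v v.
Proof.
move=> XP tT; rewrite /bid_law_given /=.
rewrite (expectation_history XP t (f := fun h => alg i h v v)) /=; last first.
  by move=> h; case: (alg_pmf i h v).
have := @after_truthful i v t [::]; rewrite potential_nil add0n; exact.
Qed.

End Truthfulness.

(** * Numerical estimates for the constants *)

(** Since [N <= 2^N], a power of a number at most [1/2] absorbs the factor [N]. *)
Lemma natr_mul_pow_half (R : realType) (e : R) N :
  0 <= e <= 1 / 2 -> N%:R * e ^+ N <= 1.
Proof.
move=> /andP[e0 e1]; apply: (@le_trans _ _ (2 ^+ N * e ^+ N)).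
  by rewrite ler_wpM2r ?exprn_ge0 // -natrX ler_nat ltnW // ltn_expl.
by rewrite -exprMn exprn_ile1 ?mulr_ge0 //; lra.
Qed.

Section Constants.
Variables (R : realType) (n H T0 : nat) (rho tau : R).
Hypotheses (n_gt0 : (0 < n)%N) (H_gt0 : (0 < H)%N).
Hypotheses (rho_gt0 : 0 < rho) (rho_le1 : rho <= 1).
Hypotheses (tau_gt0 : 0 < tau) (tau_le1 : tau <= 1).
Let x : R := tau ^+ 2 * rho ^+ 2 * T0%:R / (32 * n%:R ^+ 2 * H%:R ^+ 2).
Hypothesis T0_large : expR (- x) <= 1 / 2.

Let nz : n%:R != 0 :> R.
Proof. by rewrite gt_eqF ?ltr0n. Qed.

Let Hz : H%:R != 0 :> R.
Proof. by rewrite gt_eqF ?ltr0n. Qed.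

Let x_ge0 : 0 <= x.
Proof. by rewrite divr_ge0 ?mulr_ge0 ?exprn_ge0 // ltW. Qed.

(** From [1 - x <= exp (- x) <= 1/2] one gets [x >= 1/2], hence [T0 >= 16 n^2 H^2]. *)
Lemma exploration_ge : (H <= T0)%N.
Proof.
have xh : 1 / 2 <= x by have := le_trans (expR_ge1Dx (- x)) T0_large; move: (x) => z; lra.
have tr : tau ^+ 2 * rho ^+ 2 <= 1.
  by rewrite mulr_ile1 ?exprn_ge0 ?exprn_ile1 // ltW.
have : 16 * n%:R ^+ 2 * H%:R ^+ 2 <= T0%:R :> R.
  apply: (@le_trans _ _ (tau ^+ 2 * rho ^+ 2 * T0%:R)); last by rewrite ler_piMl.
  have d0 : 0 < 32 * n%:R ^+ 2 * H%:R ^+ 2 :> R by rewrite !mulr_gt0 ?exprn_gt0 ?ltr0n.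
  move: xh; rewrite /x ler_pdivlMr //; apply: le_trans.
  by rewrite le_eqVlt; apply/orP; left; apply/eqP; field.
rewrite -!natrX -!natrM ler_nat; apply: leq_trans.
apply: leq_trans (leq_pmull _ _); last by rewrite muln_gt0 expn_gt0 n_gt0.
by apply: leq_pmulr.
Qed.

(** With [N = n H^2], the exponent [tau T0 / (4 n)] is at least [8 N x >= (N + 1) x]. Then [N]
    copies of [exp (- x)] absorb the factor [N] and one copy remains. *)
Lemma stalling_bound :
  (n * H ^ 2)%:R / expR (tau * T0%:R / (4 * n%:R)) <= 4 * expR (- x).
Proof.
set N := (n * H ^ 2)%N.
have N1 : (1 <= N)%N by rewrite muln_gt0 n_gt0 expn_gt0 H_gt0.
have x_le : (N.+1)%:R * x <= tau * T0%:R / (4 * n%:R).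
  apply: (@le_trans _ _ (8 * N%:R * x)).
    by rewrite ler_wpM2r // -natrM ler_nat; lia.
  have -> : 8 * N%:R * x = tau * rho ^+ 2 * (tau * T0%:R / (4 * n%:R)).
    by rewrite /x /N natrM natrX; field; rewrite nz Hz.
  rewrite ler_piMl ?divr_ge0 ?mulr_ge0 //; try exact: ltW.
  by rewrite mulr_ile1 ?exprn_ge0 ?exprn_ile1 // ltW.
rewrite -expRN; apply: (@le_trans _ _ (N%:R * expR (- (N.+1%:R * x)))).
  by rewrite ler_wpM2l // ler_expR lerN2.
rewrite -mulrN expRM_natl exprSr mulrA ler_pM2r ?expR_gt0 //.
apply: (@le_trans _ _ 1); last by rewrite ler1n.
by apply: natr_mul_pow_half; rewrite expR_ge0 T0_large.
Qed.

End Constants.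

(** * Truthfulness in every round after the exploration *)

Unset Implicit Arguments.

Theorem theorem4p3 (R : realType) (n k H : nat) (p : nat -> R) (rho : R)
    (F : 'I_n -> 'I_H -> R) (gamma : nat -> R) (T0 : nat) (tau : R)
    (alg : 'I_n -> learner R (round n H) 'I_H 'I_H)
    (d : measure_display) (Omega : measurableType d)
    (P : probability Omega R) (X : nat -> Omega -> round n H)
    (H_gt0 : (0 < H)%N) (k_gt0 : (0 < k)%N) (k_lt_n : (k < n)%N)
    (p_noninc : forall j, (1 <= j < k)%N -> p j.+1 <= p j)
    (p_ge0 : 0 <= p k)
    (p_eq0 : forall j, (k < j <= n)%N -> p j = 0)
    (rho_gt0 : 0 < rho) (rho_le1 : rho <= 1)
    (p_gap : forall j, (1 <= j <= k)%N -> rho <= p j - p j.+1)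
    (F_pmf : forall i, is_pmf (F i))
    (gamma_incr : forall s t, (1 <= s <= t)%N ->
      gamma s * s%:R <= gamma t * t%:R)
    (gamma_cvg0 : gamma t @[t --> \oo] --> (0 : R))
    (alg_bidding : forall i, bidding_algorithm k p gamma T0 i (alg i))
    (X_process : auction_process P F alg X)
    (tau_gt0 : 0 < tau) (tau_le : tau <= 1 / H%:R ^+ n.-1)
    (thickness : forall i v, tau <= kth_other_pmf k F i v)
    (T0_large : expR (- (tau ^+ 2 * rho ^+ 2 * T0%:R
                         / (32 * n%:R ^+ 2 * H%:R ^+ 2))) <= 1 / 2)
    (gamma_small : forall t, (T0 <= t)%N ->
      gamma t <= tau * rho / (8 * n%:R * H%:R)) :
  forall (t : nat) (i : 'I_n) (v : 'I_H), (T0 < t)%N ->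
    let bound := 1 - H%:R * gamma t
      - 4 * expR (- (tau ^+ 2 * rho ^+ 2 * T0%:R
                     / (32 * n%:R ^+ 2 * H%:R ^+ 2))) in
    bound <= bid_law_given P alg X i t v v /\
    (0 < F i v ->
     bound <= cond_prob P [set w | bids (X t w) i = v]
                          [set w | values (X t w) i = v]).
Proof.
(* Round [t.+1] is played on a history of length [t], so the learning condition involves [gamma t],
   while the bound is stated with [gamma t.+1]. *)
move=> [//|t] i v tT; rewrite ltnS in tT => bound.
have n_gt0 : (0 < n)%N by apply: leq_ltn_trans k_lt_n.
have k_range : (0 < k < n)%N by rewrite k_gt0.
have tau1 : tau <= 1 := tau_le1 H_gt0 tau_le.
have HT : (H <= T0)%N := exploration_ge n_gt0 H_gt0 rho_gt0 rho_le1 tau_gt0 tau1 T0_large.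
have T0_gt0 : (0 < T0)%N by apply: leq_trans HT.
have alg_pmf j h c : is_pmf (alg j h c) by case: (alg_bidding j).
have g0 := gamma_ge0 T0_gt0 alg_bidding i v tT.
have lower : bound <= bid_law_given P alg X i t.+1 v v.
  apply: le_trans (bid_law_lower k_range H_gt0 T0_gt0 rho_gt0 rho_le1 p_gap
    F_pmf alg_bidding tau_gt0 tau_le thickness gamma_small i v X_process tT).
  apply: lerB; last exact: stalling_bound.
  rewrite lerD2l lerN2.
  (* Going from [gamma t] to [gamma t.+1] costs the factor [t.+1 / t], which
     the [H - 1] untruthful bids absorb since [H <= t]. *)
  have t0 : (0 < t)%N by apply: leq_trans tT.
  have := gamma_incr t t.+1; rewrite t0 leqnSn => /(_ isT) incr.
  rewrite -(ler_pM2r (x := t.+1%:R)) ?ltr0n // -mulrA.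
  rewrite -[X in _ <= X]mulrA; apply: le_trans (ler_wpM2l (ler0n _ H) incr).
  rewrite mulrCA [X in _ <= X]mulrCA ler_wpM2l // -!natrM ler_nat.
  by move: HT tT H_gt0; clear; nia.
split=> // Fv.
by rewrite (cond_prob_bid_law F_pmf alg_pmf X_process).
Qed.
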